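(* Let $0<\underline{\lambda}\le\bar{\lambda}<\infty$, let $\mathbf{A}\in\mathbb{R}^{n\times n}$ be symmetric with $\underline{\lambda}\mathbf{I}\preceq\mathbf{A}\preceq\bar{\lambda}\mathbf{I}$, and for $k\in\mathbb{N}$ let $f_k(\mathbf{x})=\frac12\mathbf{x}^\top\mathbf{A}\mathbf{x}+\mathbf{x}^\top\mathbf{b}_k$, with unique minimizer $\mathbf{x}_k^*$. Assume that the sequence $\{\mathbf{b}_k\}_{k\in\mathbb{N}}\subset\mathbb{R}^n$ has a rational $\mathcal{Z}$-transform $\mathcal{Z}[\mathbf{b}_k]=\mathbf{B}_{\mathrm N}(z)/B_{\mathrm D}(z)$, where $\mathbf{B}_{\mathrm N}(z)$ is a vector of $n$ real polynomials and $B_{\mathrm D}(z)=z^m+\sum_{i=0}^{m-1}b_iz^i$ is a real polynomial whose roots are all marginally or asymptotically stable. Let the controller be $C(z)=C_{\mathrm N}(z)/C_{\mathrm D}(z)$ with $C_{\mathrm N}(z)=\sum_{i=0}^{m-1}c_iz^i$ a real polynomial, and assume that: (c1) (internal model) $C_{\mathrm D}(z)=B_{\mathrm D}(z)$; (c2) (stability) the polynomial $B_{\mathrm D}(z)-\lambda C_{\mathrm N}(z)$ is asymptotically stable for all $\lambda\in[\underline{\lambda},\bar{\lambda}]$. Then the output $\{\mathbf{x}_k\}_{k\in\mathbb{N}}$ of the control-based online algorithm associated with $C(z)$ (defined in the context) satisfies $$\limsup_{k\to\infty}\|\mathbf{x}_k-\mathbf{x}_k^*\|=0.$$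
   Context: The $\mathcal{Z}$-transform of a sequence is $\mathcal{Z}[\mathbf{b}_k]=\sum_{k\ge0}\mathbf{b}_kz^{-k}$. A polynomial is asymptotically stable if all its roots satisfy $|z|<1$; ''marginally or asymptotically stable'' roots are roots with $|z|\le1$ (multiple roots on the unit circle, as for ramp signals, are used in the paper). $\|\cdot\|$ is the Euclidean norm. Control-based online algorithm associated with $C(z)=C_{\mathrm N}(z)/B_{\mathrm D}(z)$: let $\mathbf{F}\in\mathbb{R}^{m\times m}$ be the companion matrix with ones on the first superdiagonal, last row $(-b_0,\dots,-b_{m-1})$, and zeros elsewhere; let $\mathbf{G}=(0,\dots,0,1)^\top\in\mathbb{R}^m$ and $\mathbf{K}=(c_0,c_1,\dots,c_{m-1})\in\mathbb{R}^{1\times m}$. With state $\mathbf{w}_k\in\mathbb{R}^{nm}$ (arbitrary initial $\mathbf{w}_0$, $\mathbf{x}_0=(\mathbf{K}\otimes\mathbf{I})\mathbf{w}_0$), the algorithm is $$\mathbf{w}_{k+1}=(\mathbf{F}\otimes\mathbf{I})\mathbf{w}_k+(\mathbf{G}\otimes\mathbf{I})\nabla f_k(\mathbf{x}_k),\qquad \mathbf{x}_{k+1}=(\mathbf{K}\otimes\mathbf{I})\mathbf{w}_{k+1},$$ where $\mathbf{I}$ is the $n\times n$ identity and $\otimes$ the Kronecker product. *)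

(* Defs.v *)
From mathcomp Require Import all_boot all_order all_algebra.
From mathcomp Require Import all_classical all_reals all_analysis.
From mathcomp Require Export complex mxtens.

Set Implicit Arguments.
Unset Strict Implicit.
Unset Printing Implicit Defensive.

Import Order.TTheory GRing.Theory Num.Theory.
Import numFieldNormedType.Exports.

Local Open Scope classical_set_scope.
Local Open Scope ring_scope.
Local Open Scope complex_scope.

Section Optimization.
Context {R : realType} {n : nat}.
Implicit Types (f : 'cV[R]_n -> R) (x y b : 'cV[R]_n) (A B : 'M[R]_n).

(* The norm that MathComp-Analysis puts on matrices is the max norm. *)
Definition euclidean_norm x : R := Num.sqrt (\sum_i x i 0 ^+ 2).

Definition positive_semidefinite A := forall x, 0 <= (x^T *m A *m x) 0 0.

Definition loewner_le A B := positive_semidefinite (B - A).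

Definition quadratic A b x : R :=
  2^-1 * (x^T *m A *m x) 0 0 + (x^T *m b) 0 0.

Definition minimizer f x := forall y, f x <= f y.

Definition gradient f x : 'cV[R]_n := \col_i 'D_(delta_mx i 0) f x.

End Optimization.

Section Polynomials.
Context {R : realType}.

Definition complex_poly (p : {poly R}) : {poly R[i]} :=
  map_poly (real_complex R) p.

Definition asymptotically_stable (p : {poly R}) :=
  forall z : R[i], root (complex_poly p) z -> `|z| < 1.

(* Multiple roots on the unit circle are allowed. *)
Definition marginally_or_asymptotically_stable (p : {poly R}) :=
  forall z : R[i], root (complex_poly p) z -> `|z| <= 1.

End Polynomials.

Section ZTransform.
Context {R : realType} {n : nat}.

(* The series is required to converge to V outside some disk.  The topology of
   the complex plane is carried by the alias R[i]^o. *)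
Definition is_ztransform (b : nat -> 'cV[R]_n) (V : R[i] -> 'cV[R[i]]_n) :=
  exists r : R, forall z : R[i], r%:C < `|z| ->
    series (fun k => z ^- k *: map_mx (real_complex R) (b k) : 'cV[R[i]^o]_n)
      @ \oo --> (V z : 'cV[R[i]^o]_n).

Definition rational_vector (N : 'cV[{poly R}]_n) (D : {poly R}) (z : R[i]) :
    'cV[R[i]]_n :=
  \col_j ((complex_poly (N j 0)).[z] / (complex_poly D).[z]).

End ZTransform.

(* The controller CN / CD, with CD monic of degree m = (size CD).-1.  Then
   companionmx CD has ones on the superdiagonal and minus the non-leading
   coefficients of CD in its last row. *)
Section Algorithm.
Context {R : realType} {n : nat}.
Variables (CN CD : {poly R}).
Local Notation m := (size CD).-1.

Definition input_mx : 'cV[R]_m := \col_i (i.+1 == m)%:R.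

Definition output_mx : 'rV[R]_m := \row_j CN`_j.

(* G ⊗ I has 1 * n columns and K ⊗ I has 1 * n rows, and 1 * n is not
   convertible to n. *)
Definition state_op : 'M[R]_(m * n) := companionmx CD *t 1%:M.

Definition input_op : 'M[R]_(m * n, n) :=
  castmx (erefl, mul1n n) (input_mx *t 1%:M).

Definition output_op : 'M[R]_(n, m * n) :=
  castmx (mul1n n, erefl) (output_mx *t 1%:M).

Fixpoint algorithm_state (f : nat -> 'cV[R]_n -> R) (w0 : 'cV[R]_(m * n))
    (k : nat) : 'cV[R]_(m * n) :=
  if k is k'.+1 then
    let w := algorithm_state f w0 k' in
    state_op *m w + input_op *m gradient (f k') (output_op *m w)
  else w0.

Definition algorithm_output (f : nat -> 'cV[R]_n -> R) (w0 : 'cV[R]_(m * n))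
    (k : nat) : 'cV[R]_n :=
  output_op *m algorithm_state f w0 k.

End Algorithm.

Arguments algorithm_output {R n} CN CD f w0 k.

(* Main.v *)
Require Import Defs.
From mathcomp Require Import all_boot all_order all_algebra.
From mathcomp Require Import all_classical all_reals all_analysis.
From mathcomp Require Import ring lra.
Import Order.TTheory GRing.Theory Num.Theory.
Import numFieldNormedType.Exports.
Local Open Scope ring_scope.
Set Implicit Arguments.
Unset Strict Implicit.

(** The internal model principle, carried out in the time domain.  Let S be the
    shift of sequences, and let p(S) denote the recurrence operator of a
    polynomial p.  With e_k = A x_k + b_k, the gradient fed back by the
    algorithm, the tracking error is x_k - x*_k = A^-1 e_k, so it is enough to
    prove e -> 0.

    - The Z-transform of b is a fraction over BD, so multiplying it by BD leaves
      no negative power of z: (BD(S) b)_k = 0 for k >= 1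
      ([ztransform_recurrence]).
    - Block i of the companion state is the i-th shift of one sequence y with
      BD(S) y = e and CN(S) y = x ([algorithm_transfer]); since polynomials in S
      commute, BD(S) x = CN(S) e.
    - Hence BD(S) e - A CN(S) e = BD(S) b, which is eventually zero: since
      the controller and the signal b have the same denominator, b leaves no
      trace in the loop.
    - The left-hand side is the action on e of the polynomial matrix
      M = BD I - CN A.  Multiplying by the adjugate of M decouples the
      components: each of them satisfies (det M)(S) e_l -> 0
      ([shift_op_det]).
    - If det M vanishes at z, either BD(z) = CN(z) = 0 or BD(z) / CN(z) is an
      eigenvalue of A, thus a real number l in [lmin, lmax]; in both cases z is
      a root of some BD - l CN and |z| < 1 ([loop_det_stable]).
    - A scalar recurrence whose characteristic polynomial has all its roots in
      the open unit disk and whose right-hand side tends to 0 has only solutions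
      tending to 0: peel off one root at a time ([null_of_shift_op]). *)

(** * Recurrence operators *)

(** The action p(S) of the polynomial p on the sequence u, where S is the shift:
    linear recurrences become products of polynomials. *)
Definition shift_op (K : comNzRingType) (p : {poly K}) (u : nat -> K)
    (k : nat) : K :=
  \sum_(i < size p) p`_i * u (k + i)%N.

Section ShiftOperator.
Context {K : comNzRingType}.
Implicit Types (p q : {poly K}) (u v : nat -> K).

Lemma shift_op_widen N p u k :
  (size p <= N)%N -> shift_op p u k = \sum_(i < N) p`_i * u (k + i)%N.
Proof.
move=> pN; rewrite /shift_op (big_ord_widen N (fun i => p`_i * u (k + i)%N)) //.
rewrite big_mkcond; apply: eq_bigr => i _.
by case: ltnP => // /(nth_default 0) ->; rewrite mul0r.
Qed.

Lemma eq_shift_op p u v k :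
  (forall j, (k <= j)%N -> u j = v j) -> shift_op p u k = shift_op p v k.
Proof. by move=> uv; apply: eq_bigr => i _; rewrite uv ?leq_addr. Qed.

Lemma shift_opD p q u k :
  shift_op (p + q) u k = shift_op p u k + shift_op q u k.
Proof.
pose N := maxn (size p) (size q).
rewrite !(@shift_op_widen N) ?leq_maxl ?leq_maxr ?size_polyD //.
by rewrite -big_split /=; apply: eq_bigr => i _; rewrite coefD mulrDl.
Qed.

Lemma shift_opCM c p u k : shift_op (c%:P * p) u k = c * shift_op p u k.
Proof.
rewrite mul_polyC (@shift_op_widen (size p)) ?size_scale_leq // /shift_op.
by rewrite mulr_sumr; apply: eq_bigr => i _; rewrite coefZ mulrA.
Qed.

Lemma shift_op1 u k : shift_op 1 u k = u k.
Proof. by rewrite /shift_op size_poly1 big_ord1 coef1 mul1r addn0. Qed.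

Lemma shift_op0 u k : shift_op 0 u k = 0.
Proof. by rewrite /shift_op size_poly0 big_ord0. Qed.

Lemma shift_opXM p u k : shift_op ('X * p) u k = shift_op p u k.+1.
Proof.
rewrite mulrC (@shift_op_widen (size p).+1) ?(leq_trans (size_polyMleq _ _)) //.
  rewrite big_ord_recl coefMX mul0r add0r; apply: eq_bigr => i _.
  by rewrite coefMX /= addnS addSn.
by rewrite size_polyX addn2.
Qed.

Lemma shift_op_XsubC z u k : shift_op ('X - z%:P) u k = u k.+1 - z * u k.
Proof.
by rewrite -['X]mulr1 -polyCN -[(- z)%:P]mulr1 shift_opD shift_opXM shift_opCM
  !shift_op1 mulNr.
Qed.

Lemma shift_op_sumr (I : Type) (r : seq I) p (u : I -> nat -> K) k :
  shift_op p (fun j => \sum_(i <- r) u i j) k =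
  \sum_(i <- r) shift_op p (u i) k.
Proof.
rewrite /shift_op exchange_big /=; apply: eq_bigr => i _.
by rewrite mulr_sumr.
Qed.

Lemma shift_op_suml (I : Type) (r : seq I) (p : I -> {poly K}) u k :
  shift_op (\sum_(i <- r) p i) u k = \sum_(i <- r) shift_op (p i) u k.
Proof.
elim: r => [|i r IH]; first by rewrite !big_nil shift_op0.
by rewrite !big_cons shift_opD IH.
Qed.

Lemma shift_opDr p u v k :
  shift_op p (fun j => u j + v j) k = shift_op p u k + shift_op p v k.
Proof.
by rewrite /shift_op -big_split; apply: eq_bigr => i _; rewrite mulrDr.
Qed.

Lemma shift_opZr p c u k :
  shift_op p (fun j => c * u j) k = c * shift_op p u k.
Proof.
by rewrite /shift_op mulr_sumr; apply: eq_bigr => i _; rewrite mulrCA.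
Qed.

Lemma shift_opM p q u k :
  shift_op (p * q) u k = shift_op p (shift_op q u) k.
Proof.
elim/poly_ind: p q u k => [|p c IH] q u k; first by rewrite mul0r !shift_op0.
rewrite mulrDl !shift_opD -mulrA IH shift_opCM; congr (_ + _).
  rewrite IH; apply: eq_shift_op => j _.
  by rewrite shift_opXM -['X]mulr1 shift_opXM shift_op1.
by rewrite -[c%:P]mulr1 shift_opCM shift_op1.
Qed.

Lemma shift_opC p q u k :
  shift_op p (shift_op q u) k = shift_op q (shift_op p u) k.
Proof. by rewrite -!shift_opM mulrC. Qed.

End ShiftOperator.

Lemma shift_op_map (K L : comNzRingType) (g : {rmorphism K -> L}) p u k :
  shift_op (map_poly g p) (g \o u) k = g (shift_op p u k).
Proof.
rewrite (@shift_op_widen _ (size p)) ?size_poly // rmorph_sum.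
by apply: eq_bigr => i _; rewrite coef_map rmorphM.
Qed.

(** Cramer's rule for a coupled system of recurrences: the adjugate of M turns
    the system M(S) e into one scalar recurrence for each component of e, with
    characteristic polynomial det M. *)
Lemma shift_op_det (K : comNzRingType) n (M : 'M[{poly K}]_n)
    (e : 'I_n -> nat -> K) l k :
  shift_op (\det M) (e l) k =
  \sum_i shift_op (\adj M l i) (fun j => \sum_h shift_op (M i h) (e h) j) k.
Proof.
transitivity (\sum_h shift_op ((\adj M *m M) l h) (e h) k).
  rewrite mul_adj_mx (bigD1 l) //= big1 ?addr0 ?mxE ?eqxx ?mulr1n // => h hl.
  by rewrite mxE eq_sym (negPf hl) mulr0n shift_op0.
under eq_bigr do rewrite mxE shift_op_suml.
rewrite exchange_big; apply: eq_bigr => i _.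
by rewrite shift_op_sumr; apply: eq_bigr => h _; rewrite shift_opM.
Qed.

(** * Sequences tending to zero *)

Local Notation null u := ((u x @[x --> \oo] --> 0)%classic).
Local Notation normc := (@Normc.normc _).

Section Null.
Local Open Scope complex_scope.
Context {R : realType}.
Implicit Types (u v a eps : nat -> R).

Lemma eq_null u v : u =1 v -> null u -> null v.
Proof. by move/funext => ->. Qed.

Lemma cvg_sumr (I : finType) (u : I -> nat -> R) (l : I -> R) :
  (forall i, u i x @[x --> \oo] --> l i)%classic ->
  ((\sum_i u i k) @[k --> \oo] --> \sum_i l i)%classic.
Proof.
move=> ul; elim: (index_enum I) => [|i r IH].
  have -> : (fun k => \sum_(i <- [::]) u i k) = fun=> 0.
    by apply/funext => k; rewrite big_nil.
  by rewrite big_nil; exact: cvg_cst.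
have -> : (fun k => \sum_(h <- i :: r) u h k) =
    u i \+ fun k => \sum_(h <- r) u h k.
  by apply/funext => k; rewrite big_cons.
by rewrite big_cons; apply: cvgD (ul i) IH.
Qed.

Lemma null_sum (I : finType) (u : I -> nat -> R) :
  (forall i, null (u i)) -> null (fun k => \sum_i u i k).
Proof. by move/cvg_sumr; rewrite big1. Qed.

Lemma null_scale c u : null u -> null (fun k => c * u k).
Proof.
move=> u0; rewrite -[X in (_ --> X)%classic](mulr0 c).
by apply: cvgM => //; apply: cvg_cst.
Qed.

Lemma null_shift_op (p : {poly R}) u : null u -> null (shift_op p u).
Proof.
move=> u0; apply: null_sum => i; apply: null_scale.
by rewrite (@cvg_shiftn i R^o).
Qed.

(** Up to any d > 0, the perturbation is eventually at most (1 - q) d, and d is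
    the fixed point of t |-> q t + (1 - q) d: so a is eventually below d plus a
    geometric sequence of ratio q. *)
Lemma null_contraction q a eps : 0 <= q -> q < 1 ->
  (forall k, 0 <= a k) -> (forall k, a k.+1 <= q * a k + eps k) ->
  null eps -> null a.
Proof.
move=> q0 q1 a0 aS /cvgr0Pnorm_le eps0; apply/cvgr0Pnorm_lt => e e_gt0.
pose d := e / 2.
have d0 : 0 < d by rewrite divr_gt0.
have [N _ NP] : \forall k \near \oo%classic, `|eps k| <= (1 - q) * d.
  by apply: eps0; rewrite mulr_gt0 ?subr_gt0.
have bnd j : a (N + j)%N <= d + q ^+ j * a N.
  elim: j => [|j IH]; first by rewrite addn0 expr0 mul1r lerDr ltW.
  rewrite addnS; apply: (le_trans (aS _)).
  have /NP /(le_trans (ler_norm _)) /= : (N <= N + j)%N by rewrite leq_addr.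
  move: (ler_wpM2l q0 IH); rewrite exprS; lra.
have : null (fun j => a N * q ^+ j).
  by apply: null_scale; apply: cvg_expr; rewrite ger0_norm.
move=> /cvgr0Pnorm_lt /(_ d d0) [N' _ N'P].
exists (N + N')%N => // k /= Nk.
have -> : k = (N + (k - N))%N by rewrite subnKC // (leq_trans _ Nk) ?leq_addr.
rewrite ger0_norm //; apply: (le_lt_trans (bnd _)).
have /N'P /= : (N' <= k - N)%N.
  by rewrite leq_subRL // (leq_trans _ Nk) ?leq_addr.
move=> /(le_lt_trans (ler_norm _)); rewrite mulrC /d; lra.
Qed.

Lemma lt_normc (z : R[i]) (x : R) : (`|z| < x%:C) = (normc z < x).
Proof. by rewrite -ltcR. Qed.

(** One root: u_{k+1} - z u_k -> 0 makes |u| a perturbed contraction of ratio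
    |z|. *)
Lemma null_shift_op_XsubC (z : R[i]) (u : nat -> R[i]) : `|z| < 1 ->
  null (normc \o shift_op ('X - z%:P) u) -> null (normc \o u).
Proof.
move=> z1; apply: (@null_contraction (normc z)).
- by case: (z) => ? ?; apply: sqrtr_ge0.
- by rewrite -lt_normc.
- by move=> k /=; case: (u k) => ? ?; apply: sqrtr_ge0.
- move=> k /=; rewrite shift_op_XsubC -Normc.normcM addrC.
  by rewrite -[X in normc X <= _](subrK (z * u k)) le_normcD.
Qed.

(** Over the complex numbers p is a product of linear factors, and each of them
    can be removed by the case of one root. *)
Lemma null_of_shift_op (p : {poly R[i]}) (u : nat -> R[i]) :
  p != 0 -> (forall z, root p z -> `|z| < 1) ->
  null (normc \o shift_op p u) -> null (normc \o u).
Proof.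
move=> p0; have [s ps] := closed_field_poly_normal p.
have c0 : lead_coef p != 0 by rewrite lead_coef_eq0.
have -> : (forall z, root p z -> `|z| < 1) <-> (forall z, z \in s -> `|z| < 1).
  by split=> H z; have := H z; rewrite {1}ps rootZ // root_prod_XsubC.
rewrite ps; move: (lead_coef p) c0 => c c0 s1 cpu.
have {cpu} :
    null (normc \o shift_op (\prod_(z <- s) ('X - z%:P)) u).
  apply: eq_null (null_scale (normc c)^-1 cpu) => k /=.
  rewrite -mul_polyC shift_opCM Normc.normcM mulKf //.
  by apply: contra c0 => /eqP/Normc.eq0_normc ->.
elim: s {ps} s1 => [|z s IH] s1.
  by apply: eq_null => k /=; rewrite big_nil shift_op1.
rewrite big_cons => zs; apply: IH => [y ys|].
  by rewrite s1 ?inE ?ys ?orbT.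
apply: (@null_shift_op_XsubC z); first by rewrite s1 ?mem_head.
apply: eq_null zs => k /=.
by rewrite shift_opM.
Qed.

Lemma null_of_shift_op_real (p : {poly R}) (u : nat -> R) :
  p != 0 -> asymptotically_stable p -> null (shift_op p u) -> null u.
Proof.
have normcR x : normc (x%:C) = `|x| :> R.
  by rewrite /= expr0n addr0 sqrtr_sqr.
move=> p0 ps pu; have pu' : null (fun k => `|shift_op p u k|).
  by rewrite -(@normr0 _ R); apply: cvg_norm.
have := @null_of_shift_op (complex_poly p) (real_complex R \o u).
rewrite map_poly_eq0 => /(_ p0 ps) H; apply: norm_cvg0.
apply: eq_null (H _) => [k|]; first exact: normcR.
by apply: eq_null pu' => k; rewrite -normcR -shift_op_map.
Qed.

End Null.

(** * Eigenvalues of symmetric matrices and stability of the closed loop *)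

Section RealEigen.
Local Open Scope complex_scope.
Context {R : realType} {n : nat}.
Implicit Types (A : 'M[R]_n) (v w : 'rV[R]_n).

Local Notation dot v w := ((v *m w^T) 0 0).

Lemma dot_sym v w : dot v w = dot w v.
Proof. by rewrite !mxE; apply: eq_bigr => i _; rewrite !mxE mulrC. Qed.

Lemma dot_ge0 v : 0 <= dot v v.
Proof. by rewrite mxE sumr_ge0 // => i _; rewrite mxE sqr_ge0. Qed.

Lemma dot_gt0 v : v != 0 -> 0 < dot v v.
Proof.
rewrite lt_neqAle dot_ge0 andbT; apply: contraNneq => /esym.
rewrite mxE => /psumr_eq0P v0; apply/eqP/rowP => i.
have /v0 /(_ i isT) : forall j, true -> 0 <= v 0 j * v^T j 0.
  by move=> j _; rewrite mxE sqr_ge0.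
by rewrite !mxE => /eqP; rewrite mulf_eq0 orbb => /eqP.
Qed.

Lemma dot_symmx A v w : A^T = A -> dot (v *m A) w = dot (w *m A) v.
Proof. by move=> As; rewrite dot_sym trmx_mul As mulmxA. Qed.

Lemma loewner_scalar_le A l v :
  loewner_le l%:M A -> l * dot v v <= dot (v *m A) v.
Proof.
move/(_ v^T); rewrite trmxK mulmxBr mulmxBl mul_mx_scalar -scalemxAl.
by rewrite !mxE subr_ge0.
Qed.

Lemma loewner_le_scalar A l v :
  loewner_le A l%:M -> dot (v *m A) v <= l * dot v v.
Proof.
move/(_ v^T); rewrite trmxK mulmxBr mulmxBl mul_mx_scalar -scalemxAl.
by rewrite !mxE subr_ge0.
Qed.

(** Split a complex eigenvector into real and imaginary rows a and b, and the
    eigenvalue into x + iy.  By symmetry of A the two values of a A b^T agree,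
    which forces y (|a|^2 + |b|^2) = 0; then x is the Rayleigh quotient of the
    pair (a, b). *)
Lemma symmetric_eigen A (lmin lmax : R) (l : R[i]) (v : 'rV[R[i]]_n) :
  A^T = A -> loewner_le lmin%:M A -> loewner_le A lmax%:M ->
  v != 0 -> v *m map_mx (real_complex R) A = l *: v ->
  exists2 x : R, l = x%:C & lmin <= x <= lmax.
Proof.
move=> As Amin Amax v0 vA.
pose a := map_mx (@complex.Re R) v; pose b := map_mx (@complex.Im R) v.
case: l vA => x y vA.
have aA : a *m A = x *: a - y *: b.
  apply/rowP => j; have /rowP/(_ j) := vA; rewrite !mxE.
  move=> /(congr1 (@complex.Re R)).
  rewrite (raddf_sum (@complex.Re R)) => vAj.
  transitivity (complex.Re ((x +i* y) * v 0 j)); last by case: (v 0 j).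
  rewrite -vAj; apply: eq_bigr => i _; rewrite !mxE; case: (v 0 i) => c d /=.
  by rewrite mulr0 subr0.
have bA : b *m A = x *: b + y *: a.
  apply/rowP => j; have /rowP/(_ j) := vA; rewrite !mxE.
  move=> /(congr1 (@complex.Im R)).
  rewrite (raddf_sum (@complex.Im R)) => vAj.
  transitivity (complex.Im ((x +i* y) * v 0 j)); last by case: (v 0 j).
  rewrite -vAj; apply: eq_bigr => i _; rewrite !mxE; case: (v 0 i) => c d /=.
  by rewrite mulr0 add0r.
have N0 : 0 < dot a a + dot b b.
  have [a0|] := eqVneq a 0; last first.
    by move=> /dot_gt0 aa; apply: (lt_le_trans aa); rewrite lerDl dot_ge0.
  have [b0|] := eqVneq b 0; last first.
    by move=> /dot_gt0 bb; apply: (lt_le_trans bb); rewrite lerDr dot_ge0.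
  case/eqP: v0; apply/rowP => j; rewrite mxE.
  move/rowP/(_ j): a0; move/rowP/(_ j): b0.
  by rewrite !mxE; case: (v 0 j) => c d /= -> ->.
have dotZ (u w : 'rV[R]_n) (c : R) : dot (c *: u) w = c * dot u w.
  by rewrite -scalemxAl mxE.
have dotDl (u w z : 'rV[R]_n) (c d : R) :
    dot (c *: u + d *: w) z = c * dot u z + d * dot w z.
  by rewrite mulmxDl mxE !dotZ.
have y0 : y = 0.
  have := dot_symmx a b As; rewrite aA bA -scaleNr !dotDl (dot_sym b a) => /eqP.
  rewrite -subr_eq0 => /eqP eq0; have : y * (dot a a + dot b b) = 0.
    by apply: oppr_inj; rewrite oppr0 -[RHS]eq0; ring.
  by move/eqP; rewrite mulf_eq0 (gt_eqF N0) orbF => /eqP.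
exists x; first by rewrite y0.
have := loewner_scalar_le a Amin; have := loewner_scalar_le b Amin.
have := loewner_le_scalar a Amax; have := loewner_le_scalar b Amax.
rewrite aA bA y0 !scale0r subr0 addr0 !dotZ.
move=> h1 h2 h3 h4; apply/andP; split.
  by rewrite -(ler_pM2r N0) !mulrDr lerD.
by rewrite -(ler_pM2r N0) !mulrDr lerD.
Qed.

(** The characteristic matrix of the closed loop, obtained by feeding A times
    the controller output back to the controller. *)
Definition loop_mx A (BD CN : {poly R}) : 'M[{poly R}]_n :=
  BD%:M - CN *: map_mx polyC A.

(** A kernel vector of this matrix at z is an eigenvector of A for the value
    BD(z) / CN(z), unless CN(z) = 0, in which case BD(z) = 0 as well and z is a
    root of every BD - l CN. *)
Lemma loop_det_stable A lmin lmax BD CN :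
  A^T = A -> loewner_le lmin%:M A -> loewner_le A lmax%:M -> lmin <= lmax ->
  (forall l, lmin <= l <= lmax -> asymptotically_stable (BD - l *: CN)) ->
  asymptotically_stable (\det (loop_mx A BD CN)).
Proof.
move=> As Amin Amax lle c2 z.
have rootB l : root (complex_poly (BD - l *: CN)) z
    = ((complex_poly BD).[z] == l%:C * (complex_poly CN).[z]).
  rewrite rootE /complex_poly rmorphB /= -mul_polyC rmorphM /= map_polyC.
  by rewrite !hornerE subr_eq0.
rewrite rootE /complex_poly -det_map_mx -horner_evalE -det_map_mx => /det0P[v v0].
set M := map_mx _ _ => vM.
have {vM} : (complex_poly BD).[z] *: v =
    (complex_poly CN).[z] *: (v *m map_mx (real_complex R) A).
  apply/eqP; rewrite -subr_eq0 -vM -mul_mx_scalar scalemxAr -mulmxBr.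
  apply/eqP; congr (_ *m _).
  apply/matrixP => i j; rewrite !mxE rmorphB /= rmorphM /= map_polyC rmorphMn /=.
  by rewrite /horner_eval !hornerE hornerMn.
have [CN0|CN0] := eqVneq (complex_poly CN).[z] 0.
  rewrite CN0 scale0r => /eqP; rewrite scaler_eq0 (negPf v0) orbF => /eqP BD0.
  by apply: (c2 lmin); rewrite ?lexx // rootB BD0 CN0 mulr0.
move=> /(congr1 (GRing.scale (complex_poly CN).[z]^-1)).
rewrite !scalerA mulVf // scale1r => /esym /(symmetric_eigen As Amin Amax v0)[x xl].
by move/c2; apply; rewrite rootB -xl mulrAC mulVf ?mul1r.
Qed.

Lemma loewner_ge_unitmx A lmin :
  0 < lmin -> loewner_le lmin%:M A -> A \in unitmx.
Proof.
move=> l0 Amin; rewrite -row_free_unit; apply: inj_row_free => v vA.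
apply/eqP; apply: contraT => /dot_gt0 v0.
have := loewner_scalar_le v Amin.
by rewrite vA mul0mx [X in _ <= X]mxE leNgt mulr_gt0.
Qed.

End RealEigen.

(** * From a rational Z-transform to a recurrence *)

Section PowerSeries.
Context {R : realType}.
Local Open Scope complex_scope.
Implicit Types (a b : nat -> R).

Lemma geometric_sum_le2 (s : R) n : 0 <= s -> s <= 1 / 2 ->
  \sum_(i < n) s ^+ i <= 2.
Proof.
move=> s0 s2; have := subrX1 s n.
have : 0 <= s ^+ n by rewrite exprn_ge0.
have : 0 <= \sum_(i < n) s ^+ i by apply: sumr_ge0 => i _; rewrite exprn_ge0.
set S := \sum_(i < n) _; set p := s ^+ n; nra.
Qed.

(** If the first k coefficients vanish, dividing the sum by s^k leaves a_k plus
    a tail of size at most 2 M s, because the geometric series of ratio s <= 1/2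
    is at most 2; let s tend to 0. *)
Lemma bounded_power_series_eq0 a M : (forall k, `|a k| <= M) ->
  (forall s, 0 < s -> s <= 1 / 2 -> null (series (fun k => a k * s ^+ k))) ->
  forall k, a k = 0.
Proof.
move=> aM a0; elim/ltn_ind => k IH.
have M0 : 0 <= M by apply: le_trans (aM 0%N); apply: normr_ge0.
have small s : 0 < s -> s <= 1 / 2 -> `|a k| <= 2 * M * s.
  move=> s0 s2; rewrite -(ler_pM2r (exprn_gt0 k s0)).
  suff H j : `|a k| * s ^+ k - 2 * M * s * s ^+ k <=
             `|series (fun k => a k * s ^+ k) (j + k.+1)%N|.
    rewrite -subr_le0; have := a0 s s0 s2.
    rewrite -(@cvg_shiftn k.+1 R^o) => /cvg_norm; rewrite normr0 => cv.
    by apply: (cvgr_to_ge cv); apply: nearW => j; apply: H.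
  rewrite /series /= big_mkord addnC big_split_ord /= big_ord_recr /=.
  rewrite big1 ?add0r; last by move=> i _; rewrite IH ?mul0r.
  set T := \sum_(_ < _) _.
  have HT : `|T| <= 2 * M * s * s ^+ k.
    apply: (le_trans (ler_norm_sum _ _ _)).
    apply: (@le_trans _ _ (\sum_(i < j) M * s * s ^+ k * s ^+ i)).
      apply: ler_sum => i _; rewrite normrM (ger0_norm (exprn_ge0 _ (ltW s0))).
      apply: (@le_trans _ _ (M * s ^+ (k.+1 + i))); last first.
        by rewrite exprD exprS !mulrA.
      by rewrite ler_wpM2r ?aM // exprn_ge0 ?(ltW s0).
    rewrite -mulr_sumr (_ : 2 * M * s * s ^+ k = M * s * s ^+ k * 2); last by ring.
    apply: ler_wpM2l; first by rewrite !mulr_ge0 ?exprn_ge0 ?(ltW s0).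
    exact: geometric_sum_le2 (ltW s0) s2.
  have := lerB_normD (a k * s ^+ k) T.
  rewrite normrM (ger0_norm (exprn_ge0 k (ltW s0))).
  lra.
apply/eqP; rewrite -normr_le0; apply/ler_addgt0Pl => e e0; rewrite addr0.
(* s <= 1/2 is the range of validity of the bound, and 2 M s <= e. *)
pose s := Num.min (1 / 2) (e / (2 * M + 1)).
have D0 : 0 < 2 * M + 1 by lra.
have s0 : 0 < s by rewrite lt_min !divr_gt0.
have : s <= 1 / 2 by rewrite ge_min lexx.
move=> /(small s s0)/le_trans; apply.
have : s * (2 * M + 1) <= e by rewrite -ler_pdivlMr // ge_min lexx orbT.
nra.
Qed.

(** Convergence at one point w bounds a_k w^k, which brings the series into the
    scope of the bounded case after the rescaling of the variable by w. *)
Lemma power_series_eq0 a rho : 0 < rho ->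
  (forall w, 0 < w -> w < rho -> null (series (fun k => a k * w ^+ k))) ->
  forall k, a k = 0.
Proof.
move=> rho0 a0 k; pose w := rho / 2.
have w0 : 0 < w by rewrite divr_gt0.
have wr : w < rho by rewrite /w; lra.
have /cvg_series_bounded [M [_ aM]] : cvgn (series (fun k => a k * w ^+ k)).
  by apply/cvg_ex; exists 0; apply: a0.
have {}aM j : `|a j * w ^+ j| <= M + 1 by apply: (aM (M + 1)); rewrite ?ltrDl.
have /eqP : a k * w ^+ k = 0.
  apply: (bounded_power_series_eq0 aM (a := fun k => a k * w ^+ k)) => s s0 s2.
  have := a0 (w * s) (mulr_gt0 w0 s0); rewrite /w.
  have ws_rho : rho / 2 * s < rho by nra.
  move=> /(_ ws_rho); apply: eq_null => n; apply: eq_bigr => i _.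
  by rewrite exprMn mulrA.
by rewrite mulf_eq0 expf_eq0 (gt_eqF w0) andbF orbF => /eqP.
Qed.

(** The coefficients of w^s times the power series with coefficients a. *)
Definition delay (s : nat) a (k : nat) : R :=
  if (k < s)%N then 0 else a (k - s)%N.

Lemma cvg_series_delay s a (w l : R) :
  (series (fun k => a k * w ^+ k) k @[k --> \oo] --> l)%classic ->
  (series (fun k => delay s a k * w ^+ k) k @[k --> \oo]
    --> w ^+ s * l)%classic.
Proof.
move=> al; rewrite -(@cvg_shiftn s R^o).
have -> : [sequence series (fun k => delay s a k * w ^+ k) (n + s)%N]_n =
          fun n => w ^+ s * series (fun k => a k * w ^+ k) n.
  apply/funext => n /=; rewrite /series /= !big_mkord addnC big_split_ord /=.
  rewrite big1 ?add0r => [|i _]; last by rewrite /delay ltn_ord mul0r.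
  rewrite mulr_sumr; apply: eq_bigr => i _.
  by rewrite /delay ltnNge leq_addr /= addKn exprD mulrCA.
by apply: cvgM => //; apply: cvg_cst.
Qed.

(** With w = 1/t and L bounding both sizes, w^L (D(1/w) b(w) - N(1/w)) = 0 is a
    power series in w.  Its coefficient of index L + k, for k > 0, is the value
    at k of the recurrence D(S) b, as the polynomial w^L N(1/w) has degree at most
    L. *)
Lemma rational_series_recurrence b (N D : {poly R}) (r : R) :
  (forall t, r < t -> D.[t] != 0 /\
    (series (fun k => b k * t ^- k) k @[k --> \oo]
      --> N.[t] / D.[t])%classic) ->
  forall k, shift_op D b k.+1 = 0.
Proof.
move=> bND j.
pose L := maxn (size N) (size D).
(* The constant series 1, whose delays give the monomials of w^L N(1/w). *)
pose dirac0 (k : nat) : R := (k == 0)%:R.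
pose a k := \sum_(i < L)
  (D`_i * delay (L - i) b k - N`_i * delay (L - i) dirac0 k).
suff /(_ (L + j.+1)%N) : forall k, a k = 0.
  rewrite (@shift_op_widen _ L) ?leq_maxr // => aL; rewrite -[RHS]aL.
  apply: eq_bigr => i _; rewrite /delay ltnNge.
  rewrite (leq_trans (leq_subr _ _) (leq_addr _ _)) /=.
  rewrite subnBA ?(ltnW (ltn_ord i)) // -addnA addKn.
  by rewrite /dirac0 addSn mulr0 subr0.
pose r1 := Num.max r 1.
have r1_gt0 : 0 < r1 by rewrite lt_max ltr01 orbT.
apply: (@power_series_eq0 _ r1^-1); rewrite ?invr_gt0 // => w w0 wr.
have rw : r < w^-1.
  apply: (@le_lt_trans _ _ r1); first by rewrite le_max lexx.
  by rewrite -[r1]invrK ltf_pV2 ?posrE ?invr_gt0.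
have [Dw bw] := bND _ rw.
have {}bw : (series (fun k => b k * w ^+ k) k @[k --> \oo]
    --> N.[w^-1] / D.[w^-1])%classic.
  have -> : (fun k => b k * w ^+ k) = fun k => b k * w^-1 ^- k.
    by apply/funext => k; rewrite exprVn invrK.
  by [].
have dw : (series (fun k => dirac0 k * w ^+ k) k @[k --> \oo]
    --> (1 : R))%classic.
  rewrite -(@cvg_shiftS R^o).
  have -> : [sequence series (fun k => dirac0 k * w ^+ k) n.+1]_n = fun=> 1.
    apply/funext => n; rewrite /series /= big_mkord big_ord_recl big1.
      by rewrite addr0 /dirac0 mul1r.
    by move=> i _; rewrite mul0r.
  exact: cvg_cst.
have -> : series (fun k => a k * w ^+ k) = fun n => \sum_(i < L)
    (D`_i * series (fun k => delay (L - i) b k * w ^+ k) n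
     - N`_i * series (fun k => delay (L - i) dirac0 k * w ^+ k) n).
  apply/funext => n; rewrite /series /= /a.
  under [RHS]eq_bigr do rewrite !mulr_sumr -sumrB.
  rewrite exchange_big; apply: eq_bigr => k _; rewrite mulr_suml.
  by apply: eq_bigr => i _; rewrite mulrBl !mulrA.
have lim0 : 0 = \sum_(i < L)
    (D`_i * (w ^+ (L - i) * (N.[w^-1] / D.[w^-1]))
     - N`_i * (w ^+ (L - i) * 1)).
  have e (p : {poly R}) : (size p <= L)%N ->
      \sum_(i < L) p`_i * w ^+ (L - i) = w ^+ L * p.[w^-1].
    move=> pL; rewrite (horner_coef_wide _ pL) mulr_sumr; apply: eq_bigr => i _.
    by rewrite exprB ?unitfE ?gt_eqF ?(ltnW (ltn_ord i)) // exprVn mulrCA.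
  rewrite sumrB; under eq_bigr do rewrite mulrA.
  under [X in _ - X]eq_bigr do rewrite mulr1.
  rewrite -mulr_suml !e ?leq_maxl ?leq_maxr // -mulrA [_ * (_ / _)]mulrC.
  by rewrite mulfVK // subrr.
have := @cvg_sumr R 'I_L (fun i n =>
    D`_i * series (fun k => delay (L - i) b k * w ^+ k) n
    - N`_i * series (fun k => delay (L - i) dirac0 k * w ^+ k) n)
  (fun i : 'I_L =>
    D`_i * (w ^+ (L - i) * (N.[w^-1] / D.[w^-1]))
    - N`_i * (w ^+ (L - i) * 1)).
rewrite -lim0; apply => i.
apply: cvgB; apply: cvgM; [exact: cvg_cst| |exact: cvg_cst|];
  exact: cvg_series_delay.
Qed.

(** The Z-transform is restricted to the real half-line t > max(r, 1), where BD
    has no zero since its roots lie in the closed unit disk. *)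
Lemma ztransform_recurrence n (b : nat -> 'cV[R]_n) (BN : 'cV[{poly R}]_n)
    (BD : {poly R}) :
  BD \is monic -> marginally_or_asymptotically_stable BD ->
  is_ztransform b (rational_vector BN BD) ->
  forall l k, shift_op BD (fun j => b j l 0) k.+1 = 0.
Proof.
move=> BDm BDs [r bz] l.
apply: (@rational_series_recurrence _ (BN l 0) _ (Num.max r 1)) => t.
rewrite gt_max => /andP[rt t1].
have t0 : 0 < t by apply: lt_trans t1.
have normR (x : R) : `|x%:C| = `|x|%:C :> R[i].
  by rewrite normc_def /= expr0n addr0 sqrtr_sqr.
split.
  apply/negP => BDt; have : root (complex_poly BD) t%:C.
    by rewrite rootE horner_map fmorph_eq0.
  move/BDs; rewrite normR lecR (gtr0_norm t0); lra.
have /bz : r%:C < `|t%:C| by rewrite normR ltcR gtr0_norm.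
move=> /(cvg_comp _ (fun M : 'cV[R[i]^o]_n => M l 0))
  /(_ (@coord_continuous _ _ _ _ _ _)).
move=> /cvgrPdist_lt bl; apply/cvgrPdist_lt => e e0.
have /bl : 0 < e%:C by rewrite ltcR.
apply: filterS => k /=; rewrite mxE !horner_map -fmorph_div /=.
have -> : series (fun k => t%:C ^- k *: map_mx (real_complex R) (b k)
    : 'cV[R[i]^o]_n) k l 0 = (series (fun k => b k l 0 * t ^- k) k)%:C.
  rewrite /series /= summxE rmorph_sum; apply: eq_bigr => i _.
  by rewrite !mxE rmorphM fmorphV rmorphXn mulrC.
by rewrite -rmorphB normR ltcR.
Qed.

End PowerSeries.

(** * The controller as a recurrence *)

Section ControllerState.
Context {R : realType} {n : nat}.

Lemma mulmx_tens1 p q (B : 'M[R]_(p, q)) (w : 'cV[R]_(q * n)) i l :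
  ((B *t (1%:M : 'M[R]_n)) *m w) (mxtens_index (i, l)) 0 =
  \sum_j B i j * w (mxtens_index (j, l)) 0.
Proof.
rewrite mxE (reindex (@mxtens_index q n)) /=; last first.
  exists (@mxtens_unindex q n) => k _; first exact: mxtens_indexK.
  exact: mxtens_unindexK.
transitivity (\sum_(j < q) \sum_(h < n) (B *t (1%:M : 'M[R]_n))
    (mxtens_index (i, l)) (mxtens_index (j, h)) * w (mxtens_index (j, h)) 0).
  by rewrite pair_big /=; apply: eq_bigr => -[].
apply: eq_bigr => j _; rewrite (bigD1 l) //= big1 ?addr0 => [|h hl].
  by rewrite tensmxE mxE eqxx mulr1.
by rewrite tensmxE mxE eq_sym (negPf hl) mulr0 mul0r.
Qed.

Lemma cast_tens0 (l : 'I_n) :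
  cast_ord (esym (mul1n n)) l = mxtens_index ((0 : 'I_1), l).
Proof. by apply: val_inj; rewrite /= mul0n. Qed.

Context (CN CD : {poly R}).
Local Notation m := (size CD).-1.

Lemma output_opE (w : 'cV[R]_(m * n)) l :
  (output_op CN CD *m w) l 0 = \sum_(j < m) CN`_j * w (mxtens_index (j, l)) 0.
Proof.
transitivity
  ((output_mx CN CD *t (1%:M : 'M[R]_n) *m w) (mxtens_index (0, l)) 0).
  rewrite !mxE; apply: eq_bigr => j _; rewrite castmxE /= cast_tens0.
  by rewrite cast_ord_id.
by rewrite mulmx_tens1; apply: eq_bigr => j _; rewrite mxE.
Qed.

Lemma input_opE (g : 'cV[R]_n) i l :
  (input_op CD *m g) (mxtens_index (i, l)) 0 = (i.+1 == m)%:R * g l 0.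
Proof.
rewrite mxE (bigD1 l) //= big1 ?addr0 => [|h hl].
  by rewrite castmxE /= cast_ord_id cast_tens0 tensmxE !mxE eqxx mulr1.
rewrite castmxE /= cast_ord_id cast_tens0 tensmxE !mxE.
by rewrite [l == h]eq_sym (negPf hl) mulr0 mul0r.
Qed.

(** Away from the last row the companion matrix shifts the blocks, so block j is
    block 0 read j steps later, and the last row is the recurrence
    CD(S) y = e for the sequence y of block 0.  When CD = 1 the state is empty
    and y = e. *)
Lemma companion_realization (s : nat -> 'I_m -> R) (e : nat -> R) :
  CD \is monic -> (size CN <= m)%N ->
  (forall k i, s k.+1 i =
     \sum_j companionmx CD i j * s k j + (i.+1 == m)%:R * e k) ->
  exists y : nat -> R, (forall k, shift_op CD y k = e k) /\
    (forall k, shift_op CN y k = \sum_(j < m) CN`_j * s k j).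
Proof.
move=> CDm CNm sS.
have szCD : (size CD <= m.+1)%N by exact: leqSpred.
have lc : CD`_m = 1 by exact: monicP CDm.
have [m0|m_gt0] := posnP m.
  exists e; split=> k.
    rewrite (@shift_op_widen _ m.+1 _ _ _ szCD); move: lc; rewrite m0 => lc.
    by rewrite big_ord1 /= lc mul1r addn0.
  rewrite (shift_op_widen _ _ CNm); move: (s k); rewrite m0 => sk.
  by rewrite !big_ord0.
pose y k := s k (Ordinal m_gt0).
have sy j (jm : (j < m)%N) k : s k (Ordinal jm) = y (k + j)%N.
  elim: j jm k => [|j IH] jm k.
    by rewrite addn0 /y; congr (s k); apply: val_inj.
  have jm' := ltnW jm.
  rewrite -addSnnS -(IH jm') sS (bigD1 (Ordinal jm)) //= big1 ?addr0 => [|h hj].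
    rewrite mxE /= -eqSS prednK // (ltn_eqF jm) eqxx mul1r mul0r addr0 //.
  rewrite mxE /= -eqSS prednK // (ltn_eqF jm).
  by rewrite eq_sym (negPf (hj : h != j.+1 :> nat)) mul0r.
exists y; split=> k; last first.
  rewrite (shift_op_widen _ _ CNm); apply: eq_bigr => j _.
  by rewrite -(sy j (ltn_ord j)); congr (_ * s k _); apply: val_inj.
have lm : (m.-1 < m)%N by rewrite prednK.
rewrite (@shift_op_widen _ m.+1 _ _ _ szCD) big_ord_recr /= lc mul1r.
have -> : (k + m = k.+1 + m.-1)%N by rewrite addSnnS prednK.
rewrite -(sy _ lm) sS /= prednK // eqxx mul1r addrA -big_split.
rewrite big1 ?add0r // => j _.
rewrite mxE /= eqxx -(sy j (ltn_ord j)) mulNr.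
by rewrite (_ : Ordinal _ = j) ?subrr //; apply: val_inj.
Qed.

(** The transfer function CN / CD of the controller from the gradient to the
    iterate, written without division: y stands for the gradient divided by
    CD. *)
Lemma algorithm_transfer (f : nat -> 'cV[R]_n -> R) w0 l :
  CD \is monic -> (size CN <= m)%N ->
  exists y : nat -> R,
    (forall k, shift_op CD y k =
       gradient (f k) (algorithm_output CN CD f w0 k) l 0) /\
    (forall k, shift_op CN y k = algorithm_output CN CD f w0 k l 0).
Proof.
move=> CDm CNm.
pose s k i := algorithm_state CN f w0 k (mxtens_index (i : 'I_m, l)) 0.
have [k i|y [ye yx]] := @companion_realization s
    (fun k => gradient (f k) (algorithm_output CN CD f w0 k) l 0) CDm CNm.
  by rewrite /s /= mxE mulmx_tens1 input_opE.
by exists y; split=> // k; rewrite yx output_opE.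
Qed.

End ControllerState.

(** * Quadratic functions *)

Section Quadratic.
Context {R : realType} {n : nat}.
Implicit Types (A : 'M[R]_n) (b x v : 'cV[R]_n).

Lemma quadraticD A b x v : A^T = A ->
  quadratic A b (x + v) =
  quadratic A b x + (v^T *m (A *m x + b)) 0 0 + 2^-1 * (v^T *m A *m v) 0 0.
Proof.
move=> As; have sw : (x^T *m A *m v) 0 0 = (v^T *m A *m x) 0 0.
  by have /matrixP/(_ 0 0) : (v^T *m A *m x)^T = x^T *m A *m v;
    rewrite ?mxE // !trmx_mul As trmxK mulmxA.
have trD : (x + v)^T = x^T + v^T by rewrite linearD.
rewrite /quadratic trD !mulmxDl !mulmxDr !mulmxA.
have addE (u w : 'M[R]_1) : (u + w) 0 0 = u 0 0 + w 0 0 by rewrite mxE.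
rewrite !addE sw; lra.
Qed.

(** Along the line x + h v the function is a parabola in h whose slope at 0 is
    v^T (A x + b). *)
Lemma gradient_quadratic A b x :
  A^T = A -> gradient (quadratic A b) x = A *m x + b.
Proof.
move=> As; apply/colP => i; rewrite mxE.
pose v : 'cV[R]_n := delta_mx i 0.
pose c := 2^-1 * (v^T *m A *m v) 0 0.
have gE : (A *m x + b) i 0 = (v^T *m (A *m x + b)) 0 0.
  by rewrite /v trmx_delta -rowE [RHS]mxE.
apply: cvg_lim => //.
have : ((fun h : R => (A *m x + b) i 0 + h * c) h @[h --> 0^']
    --> (A *m x + b) i 0)%classic.
  rewrite -[X in (_ --> X)%classic]addr0.
  rewrite -[X in (_ --> _ + X)%classic](mul0r c).
  apply: cvg_within_filter.
  by apply: cvgD; [exact: cvg_cst|apply: cvgM; [exact: cvg_id|exact: cvg_cst]].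
apply: cvg_trans; apply: near_eq_cvg; near=> h.
have h0 : h != 0 by near: h; exact: nbhs_dnbhs_neq.
have trZ : (h *: v)^T = h *: v^T by rewrite linearZ.
have scE (a : R) (u : 'M[R]_1) : (a *: u) 0 0 = a * u 0 0 by rewrite mxE.
rewrite /= (addrC (h *: _)) quadraticD // trZ.
rewrite -!scalemxAl -scalemxAr !scE -gE /c.
rewrite /GRing.scale /=; set q := quadratic _ _ _; set g := _ i 0.
set d := (_ *m v) 0 0; field.
by rewrite h0.
Unshelve. all: by end_near. Qed.

Lemma minimizer_quadratic A b x : A^T = A -> positive_semidefinite A ->
  A *m x + b = 0 -> minimizer (quadratic A b) x.
Proof.
move=> As Apsd Axb y; rewrite -(subrK x y) addrC quadraticD // Axb mulmx0.
have -> : (0 : 'M[R]_1) 0 0 = 0 by rewrite mxE.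
by rewrite addr0 lerDl mulr_ge0 ?invr_ge0.
Qed.

Lemma positive_semidefinite_ge A l :
  0 <= l -> loewner_le l%:M A -> positive_semidefinite A.
Proof.
move=> l0 Al x; have := loewner_scalar_le x^T Al.
rewrite trmxK; apply: le_trans; rewrite mulr_ge0 //.
by have := dot_ge0 x^T; rewrite trmxK.
Qed.

End Quadratic.

(** * Convergence of the tracking error *)

Lemma null_euclidean_norm (R : realType) n (d : nat -> 'cV[R]_n) :
  (forall i, null (fun k => d k i 0)) -> null (fun k => euclidean_norm (d k)).
Proof.
move=> d0; rewrite -[X in (_ --> X)%classic](@sqrtr0 R).
have s0 : null (fun k => \sum_i d k i 0 ^+ 2).
  apply: null_sum => i; rewrite -[X in (_ --> X)%classic](mulr0 (0 : R)).
  by apply: cvgM.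
exact: (cvg_comp _ _ s0 (@sqrt_continuous R 0)).
Qed.

Lemma limn_esup_null (R : realType) (u : nat -> R) :
  null u -> limn_esup (EFin \o u) = 0%E.
Proof.
move=> u0; apply: (cvg_limn_einf_sup _).2.
by apply: cvg_EFin => //; apply: nearW.
Qed.

Theorem proposition1 (R : realType) (n m : nat)
  (lmin lmax : R) (lmin_gt0 : 0 < lmin) (lmin_le_lmax : lmin <= lmax)
  (A : 'M[R]_n) (A_sym : A^T = A)
  (A_ge : loewner_le lmin%:M A) (A_le : loewner_le A lmax%:M)
  (b : nat -> 'cV[R]_n)
  (f : nat -> 'cV[R]_n -> R)
  (f_def : forall k x, f k x = quadratic A (b k) x)
  (xstar : nat -> 'cV[R]_n)
  (xstar_min : forall k, unique (minimizer (f k)) (xstar k))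
  (BN : 'cV[{poly R}]_n) (BD : {poly R})
  (BD_monic : BD \is monic) (BD_deg : size BD = m.+1)
  (BD_stable : marginally_or_asymptotically_stable BD)
  (b_rational : is_ztransform b (rational_vector BN BD))
  (CN CD : {poly R}) (CN_deg : (size CN <= m)%N)
  (c1 : CD = BD)
  (c2 : forall l : R, lmin <= l <= lmax ->
        asymptotically_stable (BD - l *: CN))
  (w0 : 'cV[R]_((size CD).-1 * n)) :
  limn_esup (fun k =>
    (euclidean_norm (algorithm_output CN CD f w0 k - xstar k))%:E) = 0%E.
Proof.
subst CD; set x := algorithm_output CN BD f w0.
pose e k := A *m x k + b k.
have fE k : f k = quadratic A (b k) by apply/funext => y; rewrite f_def.
have Aunit : A \in unitmx by exact: loewner_ge_unitmx A_ge.
have xstarE k : xstar k = - (invmx A *m b k).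
  apply: (xstar_min k).2; rewrite fE; apply: minimizer_quadratic => //.
    exact: positive_semidefinite_ge (ltW lmin_gt0) A_ge.
  by rewrite mulmxN mulKVmx // addNr.
have errE k : x k - xstar k = invmx A *m e k.
  by rewrite xstarE opprK mulmxDr mulKmx.
have transfer l : forall k,
    shift_op BD (fun k => x k l 0) k = shift_op CN (fun k => e k l 0) k.
  have [y [ye yx]] : exists y, (forall k, shift_op BD y k = e k l 0) /\
      (forall k, shift_op CN y k = x k l 0).
    have [|y [ye yx]] := @algorithm_transfer _ _ CN BD f w0 l BD_monic.
      by rewrite BD_deg.
    by exists y; split=> // k; rewrite ye fE gradient_quadratic.
  move=> k; rewrite -(eq_shift_op BD (fun j _ => yx j)) shift_opC.
  by apply: eq_shift_op => j _; apply: ye.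
(* Since A BD(S) x = A CN(S) e, the part A x of e drops out of M(S) e. *)
have loopE i j : \sum_h shift_op (loop_mx A BD CN i h) (fun k => e k h 0) j
    = shift_op BD (fun k => b k i 0) j.
  transitivity (shift_op BD (fun k => e k i 0) j
      - \sum_h A i h * shift_op CN (fun k => e k h 0) j).
    have loopC h : shift_op (loop_mx A BD CN i h) (fun k => e k h 0) j =
        (i == h)%:R * shift_op BD (fun k => e k h 0) j
        - A i h * shift_op CN (fun k => e k h 0) j.
      rewrite /loop_mx !mxE (mulrC CN) -mulNr -polyCN -[BD *+ _]mulr_natl.
      rewrite -polyC_natr.
      by rewrite shift_opD !shift_opCM mulNr.
    under eq_bigr do rewrite loopC.
    rewrite sumrB (bigD1 i) //= eqxx mul1r big1 ?addr0 // => h hi.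
    by rewrite eq_sym (negPf hi) mul0r.
  under eq_bigr do rewrite -transfer -shift_opZr.
  rewrite -shift_op_sumr -mulN1r -shift_opZr -shift_opDr.
  by apply: eq_shift_op => k _; rewrite /e !mxE mulN1r addrAC subrr add0r.
have e_null l : null (fun k => e k l 0).
  have Dst := loop_det_stable A_sym A_ge A_le lmin_le_lmax c2.
  apply: (null_of_shift_op_real _ Dst).
    (* If det M were zero, 2 would be a root of it. *)
    apply/eqP => D0; have := Dst 2.
    rewrite /complex_poly D0 rmorph0 root0 => /(_ isT).
    by rewrite normr_nat ltrn1.
  under eq_fun do rewrite (shift_op_det _ (fun h k => e k h 0) l).
  apply: null_sum => i; apply: null_shift_op.
  apply: (@eq_null _ (shift_op BD (fun k => b k i 0))) => [k|].
    by rewrite loopE.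
  rewrite -(@cvg_shiftS R^o).
  apply: (@eq_null _ (fun=> 0)) => [k|]; last exact: cvg_cst.
  by rewrite /= (ztransform_recurrence BD_monic BD_stable b_rational).
apply: limn_esup_null; apply: null_euclidean_norm => i.
under eq_fun do rewrite errE mxE.
by apply: null_sum => j; apply: null_scale.
Qed.
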